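(* The fragment $\Sigma_{4,1,1}^{\mathfrak{D}}$ is undecidable.
   Context: $\mathcal{L}_{BT}$ is the first-order language (with equality) consisting of the constant symbols $e,0,1$, the binary function symbol $\circ$ and one binary relation symbol, written $\preceq$ here. The $\mathcal{L}_{BT}$-structure $\mathfrak{D}$: its universe is the set $\{\boldsymbol{0},\boldsymbol{1}\}^*$ of all finite bit strings, including the empty string $\varepsilon$; $e^{\mathfrak{D}}=\varepsilon$, $0^{\mathfrak{D}}$ is the one-bit string $\boldsymbol{0}$, $1^{\mathfrak{D}}$ is the one-bit string $\boldsymbol{1}$; $\circ^{\mathfrak{D}}$ is concatenation; and $u \preceq^{\mathfrak{D}} v$ iff $u$ is a prefix of $v$, i.e. iff there exists a bit string $x$ with $ux=v$. Bounded quantifiers: $(\exists x\preceq t)\alpha$ abbreviates $(\exists x)[x\preceq t\wedge\alpha]$ and $(\forall x\preceq t)\alpha$ abbreviates $(\forall x)[x\preceq t\rightarrow\alpha]$, where $x$ does not occur in the term $t$. The $\Sigma$-formulas are defined inductively: $\alpha$ and $\neg\alpha$ are $\Sigma$-formulas if $\alpha$ is of the form $s\preceq t$ or $s=t$ for terms $s,t$; $\alpha\vee\beta$ and $\alpha\wedge\beta$ are $\Sigma$-formulas if $\alpha,\beta$ are; $(\exists x\preceq t)\alpha$, $(\forall x\preceq t)\alpha$ and $(\exists x)\alpha$ are $\Sigma$-formulas if $\alpha$ is. A $\Sigma$-formula is a $\Sigma_{n,m,k}$-formula if it contains $n$ unbounded existential quantifiers, $m$ bounded existential quantifiers and $k$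 bounded universal quantifiers. A sentence is a formula with no free variables. The fragment $\Sigma_{n,m,k}^{\mathfrak{D}}$ is the set of $\Sigma_{n,m,k}$-sentences true in $\mathfrak{D}$. A fragment is undecidable if there is no algorithm deciding membership in this set. *)

(* Defs.v *)
From HB Require Import structures.
From mathcomp Require Import all_boot.

Set Implicit Arguments.
Unset Strict Implicit.
Unset Printing Implicit Defensive.

Inductive term : Type :=
| Var of nat
| TE
| T0
| T1
| Conc of term & term.

Inductive formula : Type :=
| Eq of term & term
| Pre of term & term
| Neg of formula
| And of formula & formula
| Or of formula & formula
| Imp of formula & formula
| Ex of nat & formula
| All of nat & formula.

Record BT_structure : Type := BTStructure {
  carrier :> Type;
  e_ : carrier;
  zero_ : carrier;
  one_ : carrier;
  conc_ : carrier -> carrier -> carrier;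
  pre_ : carrier -> carrier -> Prop
}.

Definition update (T : Type) (v : nat -> T) (x : nat) (a : T) : nat -> T :=
  fun y => if y == x then a else v y.

Fixpoint eval (M : BT_structure) (v : nat -> M) (t : term) : M :=
  match t with
  | Var x => v x
  | TE => e_ M
  | T0 => zero_ M
  | T1 => one_ M
  | Conc s t => conc_ (eval v s) (eval v t)
  end.

Fixpoint sat (M : BT_structure) (v : nat -> M) (f : formula) : Prop :=
  match f with
  | Eq s t => eval v s = eval v t
  | Pre s t => pre_ (eval v s) (eval v t)
  | Neg f => ~ sat v f
  | And f g => sat v f /\ sat v g
  | Or f g => sat v f \/ sat v g
  | Imp f g => sat v f -> sat v g
  | Ex x f => exists a : M, sat (update v x a) f
  | All x f => forall a : M, sat (update v x a) f
  end.

Definition true_in (M : BT_structure) (f : formula) : Prop :=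
  forall v : nat -> M, sat v f.

Fixpoint term_vars (t : term) : seq nat :=
  match t with
  | Var x => [:: x]
  | TE | T0 | T1 => [::]
  | Conc s t => term_vars s ++ term_vars t
  end.

Fixpoint free_vars (f : formula) : seq nat :=
  match f with
  | Eq s t | Pre s t => term_vars s ++ term_vars t
  | Neg f => free_vars f
  | And f g | Or f g | Imp f g => free_vars f ++ free_vars g
  | Ex x f | All x f => [seq y <- free_vars f | y != x]
  end.

Definition sentence (f : formula) : Prop := free_vars f = [::].

(* The booleans false and true are the bits 0 and 1. *)
Definition D : BT_structure :=
  @BTStructure (seq bool) [::] [:: false] [:: true]
    (fun u v => u ++ v) (fun u v => exists x : seq bool, u ++ x = v).

(* Sigma-formulas as they are written, with bounded quantifiers visible, so   *)
(* that the numbers of quantifiers of each kind are determined by the         *)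
(* formula; [unabbrev] eliminates the bounded-quantifier abbreviations.       *)

Inductive sigma : Type :=
| SEq of term & term
| SNeq of term & term
| SPre of term & term
| SNpre of term & term
| SOr of sigma & sigma
| SAnd of sigma & sigma
| SBEx (x : nat) (t : term) of x \notin term_vars t & sigma
| SBAll (x : nat) (t : term) of x \notin term_vars t & sigma
| SEx of nat & sigma.

Fixpoint unabbrev (f : sigma) : formula :=
  match f with
  | SEq s t => Eq s t
  | SNeq s t => Neg (Eq s t)
  | SPre s t => Pre s t
  | SNpre s t => Neg (Pre s t)
  | SOr f g => Or (unabbrev f) (unabbrev g)
  | SAnd f g => And (unabbrev f) (unabbrev g)
  | SBEx x t _ f => Ex x (And (Pre (Var x) t) (unabbrev f))
  | SBAll x t _ f => All x (Imp (Pre (Var x) t) (unabbrev f))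
  | SEx x f => Ex x (unabbrev f)
  end.

Fixpoint num_ex (f : sigma) : nat :=
  match f with
  | SEq _ _ | SNeq _ _ | SPre _ _ | SNpre _ _ => 0
  | SOr f g | SAnd f g => num_ex f + num_ex g
  | SBEx _ _ _ f | SBAll _ _ _ f => num_ex f
  | SEx _ f => (num_ex f).+1
  end.

Fixpoint num_bex (f : sigma) : nat :=
  match f with
  | SEq _ _ | SNeq _ _ | SPre _ _ | SNpre _ _ => 0
  | SOr f g | SAnd f g => num_bex f + num_bex g
  | SBEx _ _ _ f => (num_bex f).+1
  | SBAll _ _ _ f | SEx _ f => num_bex f
  end.

Fixpoint num_ball (f : sigma) : nat :=
  match f with
  | SEq _ _ | SNeq _ _ | SPre _ _ | SNpre _ _ => 0
  | SOr f g | SAnd f g => num_ball f + num_ball g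
  | SBAll _ _ _ f => (num_ball f).+1
  | SBEx _ _ _ f | SEx _ f => num_ball f
  end.

Definition is_Sigma (n m k : nat) (f : sigma) : Prop :=
  [/\ num_ex f = n, num_bex f = m & num_ball f = k].

Definition Sigma_fragment (n m k : nat) (M : BT_structure) (f : sigma) : Prop :=
  [/\ is_Sigma n m k f, sentence (unabbrev f) & true_in M (unabbrev f)].

(* Sigma-formulas as words over a finite alphabet, in Polish notation.  The   *)
(* variable of index i is the letter LVar followed by i strokes.             *)

Inductive symbol : Type :=
| LVar | LStroke | LE | L0 | L1 | LConc | LEq | LPre
| LNot | LOr | LAnd | LEx | LAll.

Definition symbol_nat (s : symbol) : nat :=
  match s with
  | LVar => 0 | LStroke => 1 | LE => 2 | L0 => 3 | L1 => 4 | LConc => 5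
  | LEq => 6 | LPre => 7 | LNot => 8 | LOr => 9 | LAnd => 10
  | LEx => 11 | LAll => 12
  end.

Definition all_symbols : seq symbol :=
  [:: LVar; LStroke; LE; L0; L1; LConc; LEq; LPre; LNot; LOr; LAnd; LEx;
      LAll].

Lemma symbol_natK : cancel symbol_nat (nth LVar all_symbols).
Proof. by case. Qed.

HB.instance Definition _ := Countable.copy symbol (can_type symbol_natK).

Lemma all_symbolsP : Finite.axiom all_symbols.
Proof. by case. Qed.

HB.instance Definition _ := isFinite.Build symbol all_symbolsP.

Definition write_var (x : nat) : seq symbol := LVar :: nseq x LStroke.

Fixpoint write_term (t : term) : seq symbol :=
  match t with
  | Var x => write_var x
  | TE => [:: LE]
  | T0 => [:: L0]
  | T1 => [:: L1]
  | Conc s t => LConc :: write_term s ++ write_term t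
  end.

Fixpoint write (f : sigma) : seq symbol :=
  match f with
  | SEq s t => LEq :: write_term s ++ write_term t
  | SNeq s t => LNot :: LEq :: write_term s ++ write_term t
  | SPre s t => LPre :: write_term s ++ write_term t
  | SNpre s t => LNot :: LPre :: write_term s ++ write_term t
  | SOr f g => LOr :: write f ++ write g
  | SAnd f g => LAnd :: write f ++ write g
  | SBEx x t _ f =>
      LEx :: LPre :: write_var x ++ write_term t ++ write f
  | SBAll x t _ f =>
      LAll :: LPre :: write_var x ++ write_term t ++ write f
  | SEx x f => LEx :: write_var x ++ write f
  end.

Definition no_stroke (w : seq symbol) : bool := head LVar w != LStroke.

Lemma strokes_cat x y u w : no_stroke u -> no_stroke w ->
  nseq x LStroke ++ u = nseq y LStroke ++ w -> x = y /\ u = w.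
Proof.
move=> hu hw.
elim: x y => [|x IH] [|y] //=.
- by move=> E; move: hu; rewrite E.
- by move=> E; move: hw; rewrite -E.
by case=> /IH [-> ->].
Qed.

Lemma no_stroke_term t w : no_stroke (write_term t ++ w).
Proof. by case: t. Qed.

Lemma no_stroke_write f w : no_stroke (write f ++ w).
Proof. by case: f. Qed.

Lemma write_term_cat s t u w : no_stroke u -> no_stroke w ->
  write_term s ++ u = write_term t ++ w -> s = t /\ u = w.
Proof.
elim: s t u w => [x||||s1 IH1 s2 IH2] [y||||t1 t2] u w hu hw //=.
- by case=> /(strokes_cat hu hw) [-> ->].
- by case=> ->.
- by case=> ->.
- by case=> ->.
case; rewrite -!catA => /IH1 []; rewrite ?no_stroke_term // => ->.
by move=> /IH2 [] // -> ->.
Qed.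

Lemma write_cat f g u w : no_stroke u -> no_stroke w ->
  write f ++ u = write g ++ w -> f = g /\ u = w.
Proof.
have two s t s' t' u' w' : no_stroke u' -> no_stroke w' ->
    (write_term s ++ write_term t) ++ u' =
    (write_term s' ++ write_term t') ++ w' ->
    [/\ s = s', t = t' & u' = w'].
  move=> hu hw; rewrite -!catA => /write_term_cat [];
    rewrite ?no_stroke_term // => ->.
  by move=> /write_term_cat [] // -> ->.
elim: f g u w => [s t|s t|s t|s t|f1 I1 f2 I2|f1 I1 f2 I2|x t p f I|x t p f I|x f I]
  [s' t'|s' t'|s' t'|s' t'|g1 g2|g1 g2|y t' q g|y t' q g|y g] u w hu hw //=.
- by case=> /two [] // -> -> ->.
- by case=> /two [] // -> -> ->.
- by case=> /two [] // -> -> ->.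
- by case=> /two [] // -> -> ->.
- case; rewrite -!catA => /I1 []; rewrite ?no_stroke_write // => ->.
  by move=> /I2 [] // -> ->.
- case; rewrite -!catA => /I1 []; rewrite ?no_stroke_write // => ->.
  by move=> /I2 [] // -> ->.
- rewrite -!catA => -[] /strokes_cat [];
    rewrite ?no_stroke_term // => exy.
  case/write_term_cat; rewrite ?no_stroke_write // => ett /I [] // -> ->.
  by case: y / exy q => q; case: t' / ett q => q; rewrite (bool_irrelevance p q).
- rewrite -!catA => -[] /strokes_cat [];
    rewrite ?no_stroke_term // => exy.
  case/write_term_cat; rewrite ?no_stroke_write // => ett /I [] // -> ->.
  by case: y / exy q => q; case: t' / ett q => q; rewrite (bool_irrelevance p q).
rewrite -!catA => -[] /strokes_cat [];
  rewrite ?no_stroke_write // => ->.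
by move=> /I [] // -> ->.
Qed.

Lemma write_inj : injective write.
Proof.
move=> f g E.
by have [] : f = g /\ [::] = [::] :> seq symbol
  by apply: write_cat => //; rewrite E.
Qed.

(* Deterministic Turing machines with input alphabet A and one two-way        *)
(* infinite tape.  A cell is blank (None) or holds an input letter or an      *)
(* auxiliary letter.                                                          *)

Inductive direction : Type := Left | Stay | Right.

Record TM (A : finType) : Type := Machine {
  state : finType;
  aux : finType;
  start : state;
  verdict : state -> option bool; (* Some b: halted, b being the answer *)
  delta : state -> option (A + aux) -> state * option (A + aux) * direction
}.

(* [tape_left] lists the cells left of the head, nearest first; [tape_right]  *)
(* starts with the scanned cell; cells beyond either list are blank.          *)
Record config (A : finType) (M : TM A) : Type := Config {
  current : state M;
  tape_left : seq (option (A + aux M));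
  tape_right : seq (option (A + aux M))
}.

Definition step (A : finType) (M : TM A) (c : config M) : config M :=
  let: Config q l r := c in
  if verdict q is Some _ then c else
  let: (q', a, d) := delta q (head None r) in
  match d with
  | Left => Config q' (behead l) (head None l :: a :: behead r)
  | Stay => Config q' l (a :: behead r)
  | Right => Config q' (a :: l) (behead r)
  end.

Definition initial (A : finType) (M : TM A) (w : seq A) : config M :=
  Config (start M) [::] [seq Some (inl a) | a <- w].

Definition decides (A : finType) (M : TM A) (L : seq A -> Prop) : Prop :=
  forall w : seq A, exists (n : nat) (b : bool),
    verdict (current (iter n (@step A M) (initial M w))) = Some b
    /\ (b = true <-> L w).

Definition undecidable (S : sigma -> Prop) : Prop :=
  ~ exists M : TM symbol, decides M (fun w => exists2 f, S f & w = write f).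

(* Main.v *)
From HB Require Import structures.
From mathcomp Require Import all_boot zify.
Require Import Defs.

Set Implicit Arguments.
Unset Strict Implicit.
Unset Printing Implicit Defensive.

(** The theorem is proved by diagonalisation.  Every machine [M] has a sentence
that is true exactly when [M] rejects that sentence, so that [M] cannot decide
the fragment.

Two ideas carry the proof.

A finite computation is recorded in one string [H].  A string [u] consists of
zeros only iff [u 0 = 0 u], an atomic formula; hence a variable can be made to
range over the natural numbers in unary, and a term such as [u u u 0 0] then
denotes the number [3 u + 2].  Take configurations made of a state and two
numbers, and rules that send a pair of linear forms in [u], [v] to another such
pair.  Each configuration becomes a block opened by [11], and the single
bounded universal quantifier says: wherever a block starts in [H], either it
is in the final state, or for some [u], [v] it is the left side of a rule and
is followed by the right side.  Blocks can be read off unambiguously, and [H]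
is finite, so the chain of moves must reach the final state
([halt_sentenceP]).  A Turing machine is such a system of rules: the half-tapes
are numerals in some base with the cell next to the head as lowest digit and
the blank as digit zero, so that pushing and popping a cell are linear
operations ([halts_run]).

The sentence reaches its own text without a universal machine.  The sentence
with parameter [n] has the form [y = 0...0] with [n] zeros in its last conjunct,
so its text is a prefix [P] that does not depend on [n], followed by [n]
copies of a fixed word and one last letter.  Choose for [n] the number whose
digits spell [P].  Before [M] is started, extra rules build its input from [n]
alone: they count down from [n], pushing the fixed word each time, and then
unload the digits of a second copy of [n], the value of [y], on top of the
result ([halts_rejects]).  The input is thus the text of the sentence. *)

(** * Systems of linear rules on two numbers *)

(** The tuple [(i, j, k, c)] stands for [i u + j v + k y + c]: a rule may match
on [u] and [v], while [y] is fixed throughout a computation. *)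
Definition lin : Type := (nat * nat * nat * nat)%type.
Definition pattern : Type := (nat * lin * lin)%type.
Definition rule : Type := (pattern * pattern)%type.
Definition conf : Type := (nat * nat * nat)%type.

Definition lin_val (u v y : nat) (l : lin) : nat :=
  let: (i, j, k, c) := l in i * u + (j * v + (k * y + c)).

Definition pat_val (u v y : nat) (p : pattern) : conf :=
  let: (q, l, r) := p in (q, lin_val u v y l, lin_val u v y r).

Definition move (rs : seq rule) (y : nat) (c d : conf) : Prop :=
  exists2 r, r \in rs &
    exists u v, c = pat_val u v y r.1 /\ d = pat_val u v y r.2.

Inductive halts (rs : seq rule) (y : nat) : conf -> Prop :=
| halts_final a b : halts rs y (0, a, b)
| halts_move c d : move rs y c d -> halts rs y d -> halts rs y c.

(** Halting only asserts that some run ends in state 0; it passes back along a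
move when that move is the only one. *)
Lemma halts_det rs y c d : c.1.1 != 0 -> move rs y c d ->
  (forall d', move rs y c d' -> d' = d) -> halts rs y c <-> halts rs y d.
Proof.
move=> c0 cd det; split=> [h|]; last exact: halts_move.
case: h c0 det {cd} => // {}c d' cd' hd' _ det.
by rewrite -(det d').
Qed.

Notation zeros n := (nseq n false).

(** * Recording a computation in a string *)

(** The three numbers are increased by one so that [11] occurs nowhere but at
the start of a block. *)
Definition block (c : conf) : seq bool :=
  let: (q, a, b) := c in
  [:: true, true & zeros q.+1 ++ true :: zeros a.+1 ++ true :: zeros b.+1].

Lemma zeros_inj a b s t :
  zeros a ++ true :: s = zeros b ++ true :: t -> a = b /\ s = t.
Proof.
by elim: a b => [|a IH] [|b] //= [] // /IH [-> ->].
Qed.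

(** The one that follows the block closes its last group of zeros, which would
otherwise be ambiguous. *)
Lemma block_inj c d s t :
  block c ++ true :: s = block d ++ true :: t -> c = d /\ s = t.
Proof.
case: c => [[q a] b]; case: d => [[q' a'] b'] /=.
case; rewrite -!catA /= => /zeros_inj [-> []].
rewrite -!catA /= => /zeros_inj [-> []].
by move=> /zeros_inj [-> ->].
Qed.

(** A string commutes with [0] iff it is a power of [0]; by this, an equation
between terms restricts a variable to unary numbers. *)
Lemma zeros_only u : u ++ [:: false] = false :: u <-> u = zeros (size u).
Proof.
split=> [|->]; last by elim: (size u) => //= n ->.
by elim: u => //= b u IH [-> /IH e]; rewrite -e.
Qed.

Definition history (cs : seq conf) : seq bool := flatten (map block cs) ++ [:: true].

Lemma history_head cs : exists s, history cs = true :: s.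
Proof. by case: cs => [|[[q a] b] cs]; eexists. Qed.

(** An occurrence of [11] cannot start inside a group of zeros. *)
Lemma skip_zeros n x s t : zeros n ++ true :: s = x ++ [:: true, true & t] ->
  exists2 x', x = zeros n ++ x' & true :: s = x' ++ [:: true, true & t].
Proof.
elim: n x => [|n IH] [|b x] //=; [by exists [::]|by exists (b :: x)|].
by case=> <- /IH [x' -> e]; exists x'.
Qed.

(** Every occurrence of [11] in a history opens a block. *)
Lemma history_split cs x t : history cs = x ++ [:: true, true & t] ->
  exists cs1 c cs2, cs = cs1 ++ c :: cs2 /\ x = flatten (map block cs1).
Proof.
rewrite /history; elim: cs x => [|c cs IH] x; first by case: x => [|? []].
case: x => [|b1 x] /=; first by move=> _; exists [::], c, cs.
have [s es] := history_head cs; rewrite /history in es.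
case: c => [[q a] b] /= [<-].
case: x => [|b2 x] [] //= <-; case: x => [|b3 x] [] //= <-.
rewrite -!catA /= => /skip_zeros [{}x ->].
case: x => [|b4 x] [] //= <-; case: x => [|b5 x] [] //= <-.
rewrite -!catA /= => /skip_zeros [{}x ->].
case: x => [|b6 x] [] //= <-; case: x => [|b7 x] [] //= <-.
rewrite es => /skip_zeros [{}x ->]; rewrite -es => /IH [cs1 [c [cs2 [-> ->]]]].
exists ((q, a, b) :: cs1), c, cs2; split=> //=.
by rewrite -!catA /= -!catA.
Qed.

(** * The sentence asserting that a computation halts *)

Definition rep (k : nat) (t : term) : term := iter k (Conc t) TE.

Notation x_ := 0 (only parsing).
Notation H_ := 1 (only parsing).
Notation y_ := 2 (only parsing).
Notation u_ := 3 (only parsing).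
Notation v_ := 4 (only parsing).
Notation z_ := 5 (only parsing).

Definition lin_term (l : lin) : term :=
  let: (i, j, k, c) := l in
  Conc (rep i (Var u_)) (Conc (rep j (Var v_)) (Conc (rep k (Var y_)) (rep c T0))).

Definition block_term (p : pattern) : term :=
  let: (q, l, r) := p in
  Conc T1 (Conc T1 (Conc (rep q.+1 T0) (Conc T1 (Conc (Conc T0 (lin_term l))
    (Conc T1 (Conc T0 (lin_term r))))))).

Definition disj (fs : seq sigma) : sigma := foldr SOr (SNeq TE TE) fs.

Definition move_atom (r : rule) : sigma :=
  SPre (Conc (Var x_) (Conc (block_term r.1) (Conc (block_term r.2) T1))) (Var H_).

Definition all_zeros (x : nat) : sigma := SEq (Conc (Var x) T0) (Conc T0 (Var x)).

(** The condition on one prefix [x] of [H]: no block starts after [x], or the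
one that does is in state 0, or it and the next block form a move. *)
Definition local (rs : seq rule) : sigma :=
  SOr (SNpre (Conc (Var x_) (Conc T1 T1)) (Var H_))
  (SOr (SPre (Conc (Var x_) (Conc T1 (Conc T1 (Conc T0 T1)))) (Var H_))
  (SEx u_ (SEx v_ (SAnd (all_zeros u_) (SAnd (all_zeros v_)
    (disj (map move_atom rs))))))).

(** Computations start in state 1, with [y] as first number. *)
Definition init (s : nat) : pattern := (1, (0, 0, 1, 0), (0, 0, 0, s)).

Definition run (rs : seq rule) (s : nat) : sigma :=
  SAnd (SPre (Conc (block_term (init s)) T1) (Var H_))
       (@SBAll x_ (Var H_) isT (local rs)).

(** The equation that fixes [y] comes last, so that [n] only affects the end of
the sentence when it is written out.  The variable [z] ranges over the empty
string alone and supplies the bounded existential quantifier. *)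
Definition halt_sentence (rs : seq rule) (s n : nat) : sigma :=
  SEx H_ (SEx y_ (@SBEx z_ TE isT
    (SAnd (run rs s) (SEq (Var y_) (rep n T0))))).

Lemma disj_quantifiers fs : all (fun f => num_ex f + num_bex f + num_ball f == 0) fs ->
  [/\ num_ex (disj fs) = 0, num_bex (disj fs) = 0 & num_ball (disj fs) = 0].
Proof.
elim: fs => //= f fs IH /andP [+ /IH [-> -> ->]].
by rewrite !addn_eq0 => /andP [/andP [/eqP-> /eqP->] /eqP->].
Qed.

Lemma halt_sentence_Sigma rs s n : is_Sigma 4 1 1 (halt_sentence rs s n).
Proof.
have [] := @disj_quantifiers (map move_atom rs); first by rewrite all_map; apply/allP.
by rewrite /is_Sigma /= => -> -> ->.
Qed.

Lemma rep_vars k t y : y \in term_vars (rep k t) -> y \in term_vars t.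
Proof. by elim: k => //= k IH; rewrite mem_cat => /orP []. Qed.

Lemma lin_term_vars l y : y \in term_vars (lin_term l) -> y \in [:: y_; u_; v_].
Proof.
case: l => [[[i j] k] c] /=; rewrite !mem_cat.
by case/or4P=> /rep_vars //=; rewrite !inE => /eqP ->.
Qed.

Lemma block_term_vars p y : y \in term_vars (block_term p) -> y \in [:: y_; u_; v_].
Proof.
case: p => [[q l] r]; rewrite /block_term /=.
rewrite !mem_cat; case/or3P => [/rep_vars // | /lin_term_vars // | /lin_term_vars //].
Qed.

Lemma moves_vars rs y : y \in free_vars (unabbrev (disj (map move_atom rs))) ->
  y \in [:: x_; H_; y_; u_; v_].
Proof.
elim: rs => //= r rs IH; rewrite cats0 in_cons !mem_cat -!orbA.
have sub (b : bool) : (b -> y \in [:: y_; u_; v_]) -> b -> y \in [:: x_; H_; y_; u_; v_].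
  by move=> h /h; rewrite !inE => ->; rewrite !orbT.
case/or4P => [/eqP -> //|||]; try by move/(sub _ (@block_term_vars _ _)).
by case/orP=> [|/IH //]; rewrite inE => /eqP ->.
Qed.

Lemma halt_sentence_closed rs s n : sentence (unabbrev (halt_sentence rs s n)).
Proof.
rewrite /sentence; case E: (free_vars _) => [//|y vs].
have: y \in free_vars (unabbrev (halt_sentence rs s n)) by rewrite E mem_head.
have no_vars k : term_vars (rep k T0) = [::] by elim: k.
rewrite /= !no_vars /= !(mem_filter, mem_cat, inE) /=.
have := @moves_vars rs y; case: (y \in free_vars _); rewrite ?inE; lia.
Qed.

Lemma eval_rep v k t : eval (M := D) v (rep k t) = flatten (nseq k (eval v t)).
Proof. by elim: k => //= k ->. Qed.

Lemma flatten_zeros k n : flatten (nseq k (zeros n)) = zeros (k * n).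
Proof. by elim: k => //= k ->; rewrite -nseqD. Qed.

Lemma eval_zeros v k : eval (M := D) v (rep k T0) = zeros k.
Proof. by rewrite eval_rep (flatten_zeros k 1) muln1. Qed.

Lemma eval_lin (e : nat -> D) u v y l :
  e u_ = zeros u -> e v_ = zeros v -> e y_ = zeros y ->
  eval e (lin_term l) = zeros (lin_val u v y l).
Proof.
case: l => [[[i j] k] c] eu ev ey /=.
by rewrite eval_zeros !eval_rep /= eu ev ey !flatten_zeros -!nseqD.
Qed.

Lemma eval_block (e : nat -> D) u v y p :
  e u_ = zeros u -> e v_ = zeros v -> e y_ = zeros y ->
  eval e (block_term p) = block (pat_val u v y p).
Proof.
case: p => [[q l] r] eu ev ey /=.
by rewrite !(eval_lin _ eu ev ey) eval_zeros.
Qed.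

Lemma sat_disj (e : nat -> D) rs :
  sat e (unabbrev (disj (map move_atom rs))) <->
  exists2 r, r \in rs & sat e (unabbrev (move_atom r)).
Proof.
elim: rs => [|r rs IH]; first by split=> [[]|[]].
split=> [[h|/IH [r' ri h]]|[r']].
- by exists r; rewrite ?mem_head.
- by exists r'; rewrite // inE ri orbT.
- by rewrite inE => /predU1P [-> h|ri h]; [left|right; apply/IH; exists r'].
Qed.


Notation is_prefix u w := (pre_ (b := D) u w).

(** The meaning of [local] once the quantified strings [u] and [v] have been
turned into numbers. *)
Definition local_cond rs y (H x : seq bool) : Prop :=
  [\/ ~ is_prefix (x ++ [:: true; true]) H,
      is_prefix (x ++ [:: true; true; false; true]) H |
      exists c d, move rs y c d /\ is_prefix (x ++ block c ++ block d ++ [:: true]) H].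

Lemma sat_local (e : nat -> D) rs y : e y_ = zeros y ->
  sat e (unabbrev (local rs)) <-> local_cond rs y (e H_) (e x_).
Proof.
move=> ey; split.
- case=> [h|[h|[u [v [/zeros_only hu [/zeros_only hv /sat_disj [r ri h]]]]]]].
  + exact: Or31.
  + exact: Or32.
  apply: Or33; exists (pat_val (size u) (size v) y r.1), (pat_val (size u) (size v) y r.2).
  split; first by exists r => //; exists (size u), (size v).
  by move: h => /=; rewrite !(eval_block _ hu hv ey).
case=> [h|h|[c [d [[r ri [u [v [-> ->]]]] h]]]]; [by left|by right; left|].
right; right; exists (zeros u), (zeros v).
split; first by apply/zeros_only; rewrite size_nseq.
split; first by apply/zeros_only; rewrite size_nseq.
apply/sat_disj; exists r => //=.
by rewrite !(@eval_block _ u v y _ erefl erefl ey).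
Qed.

Lemma sat_run (e : nat -> D) rs s y : e y_ = zeros y ->
  sat e (unabbrev (run rs s)) <->
  is_prefix (block (1, y, s) ++ [:: true]) (e H_) /\
  forall x, is_prefix x (e H_) -> local_cond rs y (e H_) x.
Proof.
move=> ey.
have -> : block (1, y, s) = eval e (block_term (init s)).
  by rewrite /= eval_zeros ey !cats0.
split=> -[h1 h2]; split=> // x hx.
- exact: (@sat_local (update e x_ x) rs y ey).1 (h2 x hx).
- exact: (@sat_local (update e x_ x) rs y ey).2 (h2 x hx).
Qed.

Lemma cat_cancel (x s t : seq bool) : x ++ s = x ++ t -> s = t.
Proof. by elim: x => //= b x IH [/IH]. Qed.

Lemma block_head c : exists s, block c = true :: s.
Proof. by case: c => [[q a] b]; eexists. Qed.

(** From a block the third case of the local condition leads to the next block,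
further to the right.  As [H] is finite this cannot go on for ever, so a block
in state 0 is met. *)
Lemma halts_of_history rs y H x c :
  (forall x, is_prefix x H -> local_cond rs y H x) ->
  is_prefix (x ++ block c ++ [:: true]) H -> halts rs y c.
Proof.
move=> loc; have [n] := ubnP (size H - size x).
elim: n x c => // n IH x c; rewrite ltnS => le [t].
rewrite -!catA /= => eH.
case: (loc x); first by eexists; exact: eH.
- case; exists (drop 2 (block c ++ true :: t)).
  by rewrite -eH -catA; case: (c) => [[q a] b].
- case=> t'; rewrite -eH -catA => /cat_cancel; case: c {eH} => [[q a] b] /= [].
  by rewrite -!catA => /(@zeros_inj 0) [<- _]; apply: halts_final.
case=> c' [d [mv [t']]]; have [s es] := block_head d.
rewrite -eH -!catA => /cat_cancel e1.
have [ec _] : c' = c /\ s ++ true :: t' = t.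
  by apply: block_inj; rewrite -e1 es.
move: mv e1; rewrite ec => mv /cat_cancel e1; apply: (halts_move mv).
apply: (IH (x ++ block c)); last by exists t'; rewrite -eH -!catA /= -e1.
have c_pos : 0 < size (block c) by case: (c) => [[q a] b].
by move: le; rewrite -eH !size_cat /=; lia.
Qed.

(** The whole run as a list, presented by what holds at each of its splittings:
that is the form in which [history_split] finds a block. *)
Lemma halts_chain rs y c : halts rs y c ->
  exists cs, forall cs1 c' cs2, c :: cs = cs1 ++ c' :: cs2 ->
    c'.1.1 = 0 \/ exists d cs3, cs2 = d :: cs3 /\ move rs y c' d.
Proof.
elim=> [a b|{}c d mv _ [cs IH]].
  by exists [::] => -[|c1 [|c2 cs1]] c' cs2 //= [<-]; left.
exists (d :: cs) => -[|c1 cs1] c' cs2 /= [].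
  by move=> <- <-; right; exists d, cs.
by move=> _ /IH.
Qed.

Lemma history_of_halts rs y c : halts rs y c ->
  exists cs, forall x, local_cond rs y (history (c :: cs)) x.
Proof.
move=> /halts_chain [cs chain]; exists cs => x.
have [|np] := boolP (prefix (x ++ [:: true; true]) (history (c :: cs))); last first.
  by apply: Or31 => -[t et]; case/prefixP: np; exists t.
case/prefixP=> t; rewrite -catA => /history_split [cs1 [c' [cs2 [e ->]]]].
rewrite {}e /history map_cat flatten_cat /= in chain *.
have [c0|[d [cs3 [-> mv]]]] := chain _ _ _ erefl.
  apply: Or32; case: c' c0 {chain} => [[q a] b] /= ->.
  by eexists; rewrite -!catA /=.
apply: Or33; exists c', d; split=> //.
have [s es] := history_head cs3.
by exists s; rewrite -!catA [[:: true] ++ s]/= -es.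
Qed.

Lemma halt_sentenceP rs s n :
  true_in D (unabbrev (halt_sentence rs s n)) <-> halts rs n (1, n, s).
Proof.
split=> [/(_ (fun=> [::])) [H [y [z [_ [hr ey]]]]]|h e].
  rewrite /= eval_zeros in ey.
  have [h1 h2] := (sat_run rs s ey).1 hr.
  by apply: (@halts_of_history _ _ H [::]).
have [cs loc] := history_of_halts h.
exists (history ((1, n, s) :: cs)), (zeros n), [::]; split; first by exists [::].
split; last by rewrite /= eval_zeros.
apply/(@sat_run _ rs s n erefl); split; last by move=> x _; apply: loc.
have [t et] := history_head cs.
by exists t; rewrite -catA [[:: true] ++ t]/= -et; apply: catA.
Qed.

(** * Turing machines as systems of linear rules *)

Definition lin_u (k c : nat) : lin := (k, 0, 0, c).
Definition lin_v (k c : nat) : lin := (0, k, 0, c).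
Definition lin_y : lin := (0, 0, 1, 0).

Lemma lin_uE u v y k c : lin_val u v y (lin_u k c) = k * u + c.
Proof. by rewrite /= !mul0n. Qed.

Lemma lin_vE u v y k c : lin_val u v y (lin_v k c) = k * v + c.
Proof. by rewrite /= !mul0n. Qed.

Lemma lin_yE u v y : lin_val u v y lin_y = y.
Proof. by rewrite /= !mul0n mul1n addn0. Qed.

Definition lin_valE := (lin_uE, lin_vE, lin_yE).
Arguments lin_val : simpl never.

Section Simulation.

Variables (A : finType) (M : TM A) (w : seq A) (y : nat).

Notation cell := (option (A + aux M)).

Definition base : nat := #|{: A + aux M}|.+1.

Definition digit (s : cell) : nat := if s is Some x then (enum_rank x).+1 else 0.

(** The head of the list is the lowest digit and a blank is the digit zero, so
that cells beyond the end of a list need no special treatment. *)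
Definition num (l : seq cell) : nat := foldr (fun s m => base * m + digit s) 0 l.

Definition letters (p : seq A) : seq cell := [seq Some (inl a) | a <- p].

Lemma digit_lt s : digit s < base.
Proof. by case: s => [x|] //=; rewrite /base ltnS. Qed.

Lemma digit_inj : injective digit.
Proof. by move=> [x|] [x'|] //= [] /val_inj /enum_rank_inj ->. Qed.

Lemma base_digit_inj m m' s s' :
  base * m + digit s = base * m' + digit s' -> m = m' /\ s = s'.
Proof.
rewrite ![base * _]mulnC => e; have := congr1 (divn^~ base) e.
rewrite /= !divnMDl // !divn_small ?digit_lt // !addn0 => em.
by split=> //; apply: digit_inj; move/eqP: e; rewrite em eqn_add2l => /eqP.
Qed.

Lemma num_head l : num l = base * num (behead l) + digit (head None l).
Proof. by case: l => //=; rewrite muln0. Qed.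

Lemma num_cat l1 l2 : num (l1 ++ l2) = base ^ size l1 * num l2 + num l1.
Proof.
elim: l1 => [|s l1 IH] /=; first by rewrite mul1n addn0.
by rewrite IH expnS mulnDr mulnA addnA.
Qed.

(** Three stages.  Loading: from [(k + 1, s)] to [(k, s)] with [w] pushed on [s],
and at [k = 0] the first number is reset to [y].  Shifting: the digits of the
first number move one by one to the second.  Running: the two numbers are the
left and right half-tapes of [M]. *)
Definition load_code := 1.
Definition shift_code := 2.
Definition run_code (q : state M) : nat := 3 + enum_rank q.

Definition load_rule : rule :=
  ((load_code, lin_u 1 1, lin_v 1 0),
   (load_code, lin_u 1 0, lin_v (base ^ size w) (num (letters w)))).

Definition loaded_rule : rule :=
  ((load_code, lin_u 0 0, lin_v 1 0), (shift_code, lin_y, lin_v 1 0)).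

Definition shift_rule (a : A) : rule :=
  ((shift_code, lin_u base (digit (Some (inl a))), lin_v 1 0),
   (shift_code, lin_u 1 0, lin_v base (digit (Some (inl a))))).

Definition shifted_rule : rule :=
  ((shift_code, lin_u 0 0, lin_v 1 0), (run_code (start M), lin_u 0 0, lin_v 1 0)).

(** The rule for state [q] with cell [c] left of the head and cell [s] scanned.
Both half-tapes are matched as a popped cell and a remainder; [u] and [v] are
the remainders.  State 0 is entered only from a rejecting state, and an
accepting state is stuck. *)
Definition run_rules (q : state M) (c s : cell) : seq rule :=
  let lhs := (run_code q, lin_u base (digit c), lin_v base (digit s)) in
  match verdict q with
  | Some true => [::]
  | Some false => [:: (lhs, (0, lin_u 0 0, lin_v 0 0))]
  | None =>
    let: (q', a, d) := delta q s in
    [:: (lhs, match d with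
      | Left => (run_code q', lin_u 1 0,
                 lin_v (base * base) (base * digit a + digit c))
      | Stay => (run_code q', lin_u base (digit c), lin_v base (digit a))
      | Right => (run_code q', lin_u (base * base) (base * digit c + digit a),
                  lin_v 1 0)
      end)]
  end.

Definition rules : seq rule :=
  [:: load_rule, loaded_rule, shifted_rule & map shift_rule (enum A) ++
    flatten [seq flatten [seq flatten [seq run_rules q c s | s <- enum {: cell}]
       | c <- enum {: cell}] | q <- enum (state M)]].

Lemma rulesP r : r \in rules ->
  [\/ r = load_rule, r = loaded_rule, r = shifted_rule |
     (exists a, r = shift_rule a) \/ exists q c s, r \in run_rules q c s].
Proof.
rewrite !inE mem_cat => /or4P [/eqP|/eqP|/eqP|]; [exact: Or41|exact: Or42|exact: Or43|].
case/orP=> [/mapP [a _ ->]|]; first by apply: Or44; left; exists a.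
case/flatten_mapP=> q _ /flatten_mapP [c _] /flatten_mapP [s _ h].
by apply: Or44; right; exists q, c, s.
Qed.

Lemma shift_rule_in a : shift_rule a \in rules.
Proof. by rewrite !inE mem_cat map_f ?mem_enum ?orbT. Qed.

Lemma run_rule_in q c s r : r \in run_rules q c s -> r \in rules.
Proof.
move=> h; rewrite !inE mem_cat; apply/or4P/Or44/orP; right.
apply/flatten_mapP; exists q; rewrite ?mem_enum //.
apply/flatten_mapP; exists c; rewrite ?mem_enum //.
by apply/flatten_mapP; exists s; rewrite ?mem_enum.
Qed.

Definition config_conf (c : config M) : conf :=
  let: Config q l r := c in (run_code q, num l, num r).

Lemma run_rules_src q c s r : r \in run_rules q c s ->
  r.1 = (run_code q, lin_u base (digit c), lin_v base (digit s)).
Proof.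
rewrite /run_rules; case: (verdict q) => [[]|] //; first by rewrite inE => /eqP ->.
by case: (delta q s) => [[q' a] d]; rewrite inE => /eqP ->.
Qed.

Lemma run_rules_step q l r : verdict q = None ->
  exists ru, run_rules q (head None l) (head None r) = [:: ru] /\
    pat_val (num (behead l)) (num (behead r)) y ru.2
      = config_conf (step (Config q l r)).
Proof.
move=> vq; rewrite /run_rules /step vq.
case: (delta q _) => [[q' a] dir]; eexists; split; first by [].
case: dir; rewrite /= !lin_valE -?num_head.
- by rewrite mul1n addn0 mulnDr addnA mulnA.
- by [].
- by rewrite mul1n addn0 (num_head l) mulnDr addnA mulnA.
Qed.

Lemma run_rules_match q l r ru :
  ru \in run_rules q (head None l) (head None r) ->
  pat_val (num (behead l)) (num (behead r)) y ru.1 = config_conf (Config q l r).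
Proof.
by move/run_rules_src=> ->; rewrite /pat_val !lin_valE -!num_head.
Qed.

(** Digits are determined by the numbers, so only the rules for the actual state
and cells apply. *)
Lemma run_moveP q l r d : move rules y (config_conf (Config q l r)) d <->
  exists2 ru, ru \in run_rules q (head None l) (head None r) &
    d = pat_val (num (behead l)) (num (behead r)) y ru.2.
Proof.
split=> [|[ru ri ->]]; last first.
  exists ru; first exact: run_rule_in ri.
  by exists (num (behead l)), (num (behead r)); rewrite (run_rules_match ri).
case=> ru /rulesP [->|->|->|[[a ->]|[q' [c [s ri]]]]] [u [v [e ->]]] //.
move: e; rewrite (run_rules_src ri) /= !lin_valE => -[eq el er].
have eq' : q = q' by apply/enum_rank_inj/val_inj/eq.
move: el er; rewrite num_head (num_head r).
case/base_digit_inj=> eu ec /base_digit_inj [ev es].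
by exists ru; rewrite ?eq' ?ec ?es // eu ev.
Qed.

Definition rejects (c : config M) : Prop :=
  exists k, verdict (current (iter k (@step A M) c)) = Some false.

Lemma halts_run c : halts rules y (config_conf c) <-> rejects c.
Proof.
split=> [h|].
  move e: (config_conf c) h => d h.
  elim: h c e => {d} [a b|d d' mv hd IH] [q l r] // e.
  move: mv; rewrite -e => /run_moveP [ru ri ed].
  case vq: (verdict q) => [[]|]; first by move: ri; rewrite /run_rules vq.
    by exists 0.
  have [ru' [eru es]] := run_rules_step l r vq.
  move: ri; rewrite eru inE => /eqP er.
  have [|k hk] := IH (step (Config q l r)); first by rewrite -es -er.
  by exists k.+1; rewrite iterSr.
case=> k; elim: k c => [|k IH] [q l r] /=.
  move=> vq; apply: (@halts_move _ _ _ (0, 0, 0)); last exact: halts_final.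
  by apply/run_moveP; rewrite /run_rules vq; eexists; [exact: mem_head|rewrite /= !lin_valE].
rewrite -/(iter k.+1 _ _) iterSr => /IH.
case vq: (verdict q) => [b|]; first by rewrite /step vq.
have [ru [er <-]] := run_rules_step l r vq.
apply: halts_move; apply/run_moveP.
by exists ru; rewrite // er mem_head.
Qed.

Lemma halts_load k l : halts rules y (load_code, k, num l) <->
  halts rules y (shift_code, y, num (iter k (cat (letters w)) l)).
Proof.
elim: k l => [|k IH] l.
  apply: halts_det => [//||d'].
    exists loaded_rule; first by rewrite !inE eqxx orbT.
    by exists 0, (num l); rewrite /= !lin_valE !mul1n !addn0.
  case=> ru /rulesP [->|->|->|[[a ->]|[q [c [s /run_rules_src es]]]]] [u [v [+ ->]]] //.
  - by rewrite /= !lin_valE !mul1n addn1.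
  - by rewrite /= !lin_valE !mul1n !addn0 => -[->].
  - by rewrite es.
rewrite iterSr -IH; apply: halts_det => [//||d'].
  exists load_rule; first by rewrite mem_head.
  by exists k, (num l); rewrite /= !lin_valE num_cat size_map !mul1n !addn0 addn1.
case=> ru /rulesP [->|->|->|[[a ->]|[q [c [s /run_rules_src es]]]]] [u [v [+ ->]]] //.
- rewrite /= !lin_valE num_cat size_map !mul1n !addn0 addn1.
  by case=> -> ->.
- by rewrite es.
Qed.

Lemma halts_shift p l : halts rules y (shift_code, num (letters p), num l) <->
  rejects (Config (start M) [::] (catrev (letters p) l)).
Proof.
elim: p l => [|a p IH] l.
  rewrite -halts_run; apply: halts_det => [//||d'].
    exists shifted_rule; first by rewrite !inE eqxx !orbT.
    by exists 0, (num l); rewrite /= !lin_valE !mul1n !addn0.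
  case=> ru /rulesP [->|->|->|[[a ->]|[q [c [s /run_rules_src es]]]]] [u [v [+ ->]]] //.
  - by rewrite /= !lin_valE !mul1n !addn0 => -[->].
  - by rewrite /= !lin_valE /= addnS.
  - by rewrite es.
rewrite /= -IH; apply: halts_det => [//||d'].
  exists (shift_rule a); first exact: shift_rule_in.
  by exists (num (letters p)), (num l); rewrite /= !lin_valE !mul1n !addn0.
case=> ru /rulesP [->|->|->|[[b ->]|[q [c [s /run_rules_src es]]]]] [u [v [+ ->]]] //.
- by rewrite /= !lin_valE /= addnS.
- rewrite /= !lin_valE !mul1n !addn0.
  by case=> /(@base_digit_inj _ _ (Some (inl a)) (Some (inl b))) [-> [->]] ->.
- by rewrite es.
Qed.

(** Shifting reverses the order of the digits, hence [rev p]. *)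
Lemma halts_rejects p t : y = num (letters (rev p)) ->
  halts rules y (load_code, y, num (letters t)) <->
  rejects (initial M (p ++ iter y (cat w) t)).
Proof.
move=> ey; rewrite halts_load {2}ey halts_shift.
suff -> : catrev (letters (rev p)) (iter y (cat (letters w)) (letters t))
  = letters (p ++ iter y (cat w) t) by [].
rewrite catrevE /letters -map_rev revK map_cat; congr (_ ++ _).
by elim: (y) => //= k ->; rewrite map_cat.
Qed.

End Simulation.

(** * The diagonal argument *)

(** The part of [write (halt_sentence rs s n)] that does not depend on [n]. *)
Definition sentence_prefix (rs : seq rule) (s : nat) : seq symbol :=
  LEx :: write_var H_ ++ LEx :: write_var y_ ++ LEx :: LPre ::
  write_var z_ ++ LE :: LAnd :: write (run rs s) ++ LEq :: write_var y_.

Lemma write_halt_sentence rs s n : write (halt_sentence rs s n) =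
  sentence_prefix rs s ++ iter n (cat [:: LConc; L0]) [:: LE].
Proof.
have -> : iter n (cat [:: LConc; L0]) [:: LE] = write_term (rep n T0).
  by elim: n => //= k ->.
rewrite /halt_sentence /sentence_prefix.
by move: (run rs s) => F /=; rewrite -catA.
Qed.

(** A halted configuration is a fixed point of [step], so two runs that halt
agree on the verdict. *)
Lemma verdict_iter (A : finType) (M : TM A) c m k b :
  verdict (current (iter m (@step A M) c)) = Some b ->
  verdict (current (iter (k + m) (@step A M) c)) = Some b.
Proof.
move=> h; elim: k => //= k.
by case: (iter (k + m) _ _) => q l r /= vq; rewrite vq.
Qed.

Theorem theorem18 : undecidable (Sigma_fragment 4 1 1 D).
Proof.
case=> M dec.
pose w := [:: LConc; L0].
pose rs := rules M w.
pose s := num (letters M [:: LE]).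
pose P := sentence_prefix rs s.
(* The digits of [n], lowest first, are the letters of [P] from last to first. *)
pose n := num (letters M (rev P)).
pose f := halt_sentence rs s n.
have truth : true_in D (unabbrev f) <-> rejects (initial M (write f)).
  by rewrite halt_sentenceP write_halt_sentence; apply: halts_rejects.
have frag : (exists2 g, Sigma_fragment 4 1 1 D g & write f = write g)
    <-> true_in D (unabbrev f).
  split=> [[g [_ _ hg] /write_inj ->] //|h].
  by exists f => //; split; [exact: halt_sentence_Sigma|exact: halt_sentence_closed|].
(* Whatever [M] answers on the text of [f], the answer is wrong. *)
have [k [b [hb]]] := dec (write f); rewrite frag truth.
case: b hb => hb [h1 h2]; last by have := h2 (ex_intro _ k hb).
have [k' hk'] := h1 erefl.
have := verdict_iter k' hb; rewrite addnC => e.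
by have := verdict_iter k hk'; rewrite e.
Qed.
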